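(* Let $d\ge1$ and $X,Y\in M_{2d}(\mathbb{R})$. Then the following are equivalent: (i) There exist $d'\ge1$ and a $(J_{2d}\oplus J_{2d'})$-symplectic matrix $L=\begin{bmatrix}X&L_{12}\\L_{21}&L_{22}\end{bmatrix}\in M_{2(d+d')}(\mathbb{R})$ with $L_{21}^TL_{21}=Y$, where $L_{12}^T,L_{21}\in M_{2d'\times2d}(\mathbb{R})$ and $L_{22}\in M_{2d'}(\mathbb{R})$. (ii) $Y+i(J_{2d}-X^TJ_{2d}X)\ge0$. (iii) $Y-i(J_{2d}-X^TJ_{2d}X)\ge0$. Moreover, in each of the statements (i), (ii) and (iii), the matrix $Y$ is necessarily positive.
   Context: $J_{2n}=\begin{bmatrix}0&I_n\\-I_n&0\end{bmatrix}\in M_{2n}(\mathbb{R})$. A matrix $L\in M_{2(d+d')}(\mathbb{R})$ is $(J_{2d}\oplus J_{2d'})$-symplectic if $L^T(J_{2d}\oplus J_{2d'})L=J_{2d}\oplus J_{2d'}$. For a complex matrix $A$, $A\ge0$ means $A$ is Hermitian positive semidefinite; a real matrix is called positive if it is symmetric positive semidefinite. *)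

(* Defs.v *)
From HB Require Import structures.
From mathcomp Require Import all_boot all_order all_algebra.
From mathcomp Require Import reals complex.

Set Implicit Arguments.
Unset Strict Implicit.
Unset Printing Implicit Defensive.

Import Order.TTheory GRing.Theory Num.Theory.
Local Open Scope ring_scope.
Local Open Scope sesquilinear_scope.

(* J_{2n}; even dimensions 2n are written n + n, so that the n x n blocks are
   those of the type. *)
Definition Jmx (R : realType) (n : nat) : 'M[R]_(n + n) :=
  block_mx 0 1%:M (- 1%:M) 0.

Definition dsum_mx (R : realType) (m n : nat) (A : 'M[R]_m) (B : 'M[R]_n) :
  'M[R]_(m + n) := block_mx A 0 0 B.

Definition symplectic (R : realType) (n : nat) (Omega L : 'M[R]_n) : Prop :=
  L^T *m Omega *m L = Omega.

Definition complexify (R : realType) (m n : nat) (A : 'M[R]_(m, n)) :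
  'M[R[i]]_(m, n) := map_mx (real_complex R) A.

(* The order on R[i] is partial: 0 <= z means that z is real and nonnegative. *)
Definition hermitian_psd (R : realType) (n : nat) (A : 'M[R[i]]_n) : Prop :=
  A \is hermsymmx /\ forall v : 'cV[R[i]]_n, 0 <= (v^t* *m A *m v) 0 0.

Definition real_psd (R : realType) (n : nat) (A : 'M[R]_n) : Prop :=
  A \is symmetricmx /\ forall v : 'cV[R]_n, 0 <= (v^T *m A *m v) 0 0.

(* Main.v *)
(* If L is symplectic then the top-left block of its defining equation reads
   K := J - X^T J X = L21^T J' L21, while Y = L21^T L21; thus the data of L21
   amounts to writing Y = P^T P + Q^T Q and K = P^T Q - Q^T P (L21 = [P; Q]),
   that is, to a Gram factorisation Y + iK = (P + iQ)^* (P + iQ), which exists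
   exactly when Y + iK >= 0.  Exchanging P and Q changes the sign of K.
   Given the isometry W = [X; L21] from (V, J) to (V + E, J + J'), with adjoint
   W', the symplectic analogue of the Halmos dilation, [[W, 1 - W W'], [0, W']],
   completes W to a symplectic matrix once E is enlarged to V + E. *)
Require Import Defs.
From mathcomp Require Import all_boot all_order all_algebra.
From mathcomp Require Import reals complex.

Set Implicit Arguments.
Unset Strict Implicit.
Unset Printing Implicit Defensive.

Import GRing.Theory Num.Theory.

Local Open Scope ring_scope.
Local Open Scope sesquilinear_scope.

Section GramFactorisation.
Variable R : realType.

Lemma complexify_rect_inj m n (A B A' B' : 'M[R]_(m, n)) :
  complexify A + 'i%C *: complexify B = complexify A' + 'i%C *: complexify B' ->
  A = A' /\ B = B'.
Proof.
move=> /matrixP eqAB; split; apply/matrixP => i j; have := eqAB i j.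
  by rewrite !mxE => /(congr1 (@complex.Re R)) /=;
    rewrite !(mul0r, mulr0, mul1r, subr0, addr0).
by rewrite !mxE => /(congr1 (@complex.Im R)) /=;
  rewrite !(mul0r, mulr0, mul1r, add0r, addr0).
Qed.

Lemma complexify_rect m n (B : 'M[R[i]]_(m, n)) :
  B = complexify (map_mx (@complex.Re R) B) +
      'i%C *: complexify (map_mx (@complex.Im R) B).
Proof. by apply/matrixP => i j; rewrite !mxE -complexE. Qed.

Lemma complexifyN m n (A : 'M[R]_(m, n)) : complexify (- A) = - complexify A.
Proof. exact: (map_mxN (real_complex R)). Qed.

Lemma trmxC_rect m n (P Q : 'M[R]_(m, n)) :
  (complexify P + 'i%C *: complexify Q)^t* =
  complexify P^T - 'i%C *: complexify Q^T.
Proof.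
apply/matrixP => i j; rewrite !mxE; apply/eqP; rewrite eq_complex /=.
by rewrite !(mul0r, mulr0, mul1r, addr0, add0r, subr0, oppr0) !eqxx.
Qed.

Lemma Jmx_gram n m (P Q : 'M[R]_(n, m)) :
  (col_mx P Q)^T *m Jmx R n *m col_mx P Q = P^T *m Q - Q^T *m P.
Proof.
rewrite -mulmxA mul_block_col !mul0mx mul1mx mulNmx mul1mx add0r addr0.
by rewrite tr_col_mx mul_row_col mulmxN.
Qed.

Lemma rect_gram n m (P Q : 'M[R]_(n, m)) (L := col_mx P Q)
    (B := complexify P + 'i%C *: complexify Q) :
  B^t* *m B =
  complexify (L^T *m L) + 'i%C *: complexify (L^T *m Jmx R n *m L).
Proof.
rewrite Jmx_gram /B trmxC_rect tr_col_mx mul_row_col /complexify.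
rewrite map_mxD map_mxB !map_mxM /= mulmxDl !mulmxDr !mulNmx.
rewrite -!scalemxAr -!scalemxAl scalerA -expr2 sqr_i scaleN1r opprK scalerBr.
by rewrite -!addrA; congr (_ + _); rewrite addrA addrC addrA addrAC.
Qed.

Lemma gram_hermitian_psd m n (B : 'M[R[i]]_(m, n)) : hermitian_psd (B^t* *m B).
Proof.
split.
  by apply/is_hermitianmxP; rewrite expr0 scale1r trmx_mul map_mxM trmxCK.
move=> v; rewrite mulmxA -map_mxM -trmx_mul -mulmxA mxE sumr_ge0 // => i _.
by rewrite !mxE mulrC mul_conjC_ge0.
Qed.

(** By the spectral theorem [A] is unitarily diagonalisable; its eigenvalues are nonnegative, so [B]
    can be taken as the square root of the diagonal part times the unitary [S]. *)
Lemma hermitian_psd_gram n (A : 'M[R[i]]_n) :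
  hermitian_psd A -> exists B : 'M[R[i]]_n, A = B^t* *m B.
Proof.
case=> herA psdA; have normA := hermitian_normalmx herA.
have unitS := spectral_unitarymx A.
set S := spectralmx A in unitS; set D := spectral_diag A.
have defA : A = S^t* *m diag_mx D *m S.
  by rewrite -invmx_unitary //; apply/orthomx_spectralP.
have SSt : S *m S^t* = 1%:M by apply/unitarymxP.
have D_ge0 i : 0 <= D 0 i.
  (* The test vector is the [i]-th eigenvector of [A], on which the form takes the value [D 0 i]. *)
  have := psdA (S^t* *m delta_mx i 0).
  rewrite trmx_mul map_mxM trmxCK [in X in 0 <= X]defA !mulmxA.
  rewrite -(mulmxA _ S) SSt mulmx1 -(mulmxA _ S) SSt mulmx1.
  rewrite trmx_delta map_delta_mx -rowE -colE.
  by rewrite !mxE eqxx mulr1n.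
exists (diag_mx (map_mx sqrtC D) *m S).
rewrite trmx_mul map_mxM tr_diag_mx map_diag_mx mulmxA -(mulmxA _ (diag_mx _)).
have -> : diag_mx (map_mx Num.conj (map_mx sqrtC D)) *m
    diag_mx (map_mx sqrtC D) = diag_mx D; last exact: defA.
rewrite mulmx_diag; congr diag_mx; apply/rowP => i; rewrite !mxE.
(* The root of a nonnegative number is real, hence fixed by conjugation. *)
apply/esym; rewrite -[LHS]sqrtCK expr2; congr (_ * _); apply/esym/geC0_conj.
by rewrite sqrtC_ge0.
Qed.

Lemma hermitian_psd_rectP n (Y K : 'M[R]_n) :
  hermitian_psd (complexify Y + 'i%C *: complexify K) <->
  exists m (L : 'M[R]_(m + m, n)), L^T *m L = Y /\ L^T *m Jmx R m *m L = K.
Proof.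
split=> [/hermitian_psd_gram[B]|[m [L [<- <-]]]].
  rewrite [B]complexify_rect rect_gram => /complexify_rect_inj[eqY eqK].
  by exists n; eexists; split; symmetry; [exact: eqY | exact: eqK].
by rewrite -[L]vsubmxK -rect_gram; apply: gram_hermitian_psd.
Qed.

Lemma hermitian_psd_rectN n (Y K : 'M[R]_n) :
  hermitian_psd (complexify Y + 'i%C *: complexify K) <->
  hermitian_psd (complexify Y - 'i%C *: complexify K).
Proof.
(* One implication for every [Z] suffices: the converse is the case [Z = - K]. *)
have swap Z : hermitian_psd (complexify Y + 'i%C *: complexify Z) ->
    hermitian_psd (complexify Y - 'i%C *: complexify Z).
  move=> /hermitian_psd_rectP[m [L [<- <-]]].
  rewrite -scalerN -complexifyN; apply/hermitian_psd_rectP.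
  rewrite -[L]vsubmxK; move: (usubmx L) (dsubmx L) => P Q.
  (* Since [Q + iP = i(P - iQ)], the exchange conjugates the complex factor up to a unit scalar, and
     so conjugates its Gram matrix. *)
  exists m, (col_mx Q P); rewrite !Jmx_gram opprB; split=> //.
  by rewrite !tr_col_mx !mul_row_col addrC.
split; first exact: swap.
rewrite -scalerN -complexifyN => /swap.
by rewrite -scalerN -complexifyN opprK.
Qed.

Lemma gram_real_psd m n (L : 'M[R]_(m, n)) : real_psd (L^T *m L).
Proof.
split.
  by apply/is_hermitianmxP; rewrite expr0 scale1r map_mx_id ?trmx_mul ?trmxK.
move=> v; rewrite mulmxA -trmx_mul -mulmxA mxE sumr_ge0 // => i _.
by rewrite !mxE -expr2 sqr_ge0.
Qed.

End GramFactorisation.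

Section Dilation.
Variable R : realType.

Lemma Jmx_tr n : (Jmx R n)^T = - Jmx R n.
Proof.
by rewrite /Jmx tr_block_mx opp_block_mx !trmx0 linearN /= trmx1 !oppr0 opprK.
Qed.

Lemma Jmx_sqr n : Jmx R n *m Jmx R n = - 1%:M.
Proof.
rewrite /Jmx mulmx_block.
rewrite !(mul0mx, mulmx0, add0r, addr0, mulmxN, mul1mx, mulNmx).
by rewrite -[RHS]scaleN1r scalar_mx_block scale_block_mx !scaler0 scaleN1r.
Qed.

(* Splits the canonical coordinates of R^2(m+n) into those of R^2m and R^2n. *)
Definition regroup m n : 'M[R]_((m + n) + (m + n), (m + m) + (n + n)) :=
  block_mx (block_mx 1%:M 0 0 0) (block_mx 0 0 1%:M 0)
           (block_mx 0 1%:M 0 0) (block_mx 0 0 0 1%:M).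

Let simpmx := (@mulmx_block R, @tr_block_mx R, @trmx0 R, @trmx1 R, @mul0mx R,
  @mulmx0 R, @mul1mx R, @mulmx1 R, @add0r, @addr0, @mulNmx R, @mulmxN R,
  @oppr0, @add_block_mx R, @opp_block_mx R, @opprK).

(** Orthogonality ensures that regrouping coordinates leaves the Gram matrix of the lower-left block
    unchanged. *)
Lemma regroup_orth m n : (regroup m n)^T *m regroup m n = 1%:M.
Proof. by rewrite /regroup !(simpmx, block_mx0) -!scalar_mx_block. Qed.

Lemma regroup_Jmx m n :
  (regroup m n)^T *m Jmx R (m + n) *m regroup m n =
  dsum_mx (Jmx R m) (Jmx R n).
Proof. by rewrite /regroup /Jmx /dsum_mx !(simpmx, block_mx0). Qed.

Lemma regroup_JmxV m n :
  regroup m n *m dsum_mx (Jmx R m) (Jmx R n) *m (regroup m n)^T =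
  Jmx R (m + n).
Proof.
have PPt : regroup m n *m (regroup m n)^T = 1%:M.
  by rewrite /regroup !(simpmx, block_mx0) -!scalar_mx_block.
by rewrite -regroup_Jmx !mulmxA PPt mul1mx -mulmxA PPt mulmx1.
Qed.

(** As [A] has inverse [- A], [W'] is the adjoint of [W] for the forms [A] and [Om], and [W'] is a
    left inverse of [W]. Thus [N] projects along the range of [W] onto its [Om]-orthogonal
    complement. *)
Lemma halmos_dilation p q (A : 'M[R]_p) (B : 'M[R]_q)
    (X : 'M[R]_p) (L : 'M[R]_(q, p)) :
    A^T = - A -> B^T = - B -> A *m A = - 1%:M ->
    X^T *m A *m X + L^T *m B *m L = A ->
  exists G H, (block_mx X G (col_mx 0 L) H)^T *m dsum_mx A (dsum_mx A B) *m
              block_mx X G (col_mx 0 L) H = dsum_mx A (dsum_mx A B).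
Proof.
move=> trA trB sqrA isoXL; pose Om := dsum_mx A B; pose W := col_mx X L.
pose W' := - (A *m (W^T *m Om)); pose N := 1%:M - W *m W'.
have AW' : A *m W' = W^T *m Om.
  by rewrite /W' mulmxN (mulmxA A A) sqrA mulNmx mul1mx opprK.
have trOm : Om^T = - Om.
  by rewrite /Om /dsum_mx tr_block_mx trA trB !trmx0 opp_block_mx !oppr0.
have OmW : Om *m W = W'^T *m A.
  have := congr1 trmx AW'; rewrite !trmx_mul trmxK trA trOm mulmxN mulNmx.
  by move/oppr_inj.
have WOW : W^T *m Om *m W = A.
  rewrite tr_col_mx mul_row_block !mulmx0 addr0 add0r mul_row_col.
  exact: isoXL.
have WON : W^T *m Om *m N = 0.
  by rewrite mulmxBr mulmx1 mulmxA WOW AW' subrr.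
(* [Om] splits into its restriction to that complement and the pullback of [A] along [W']. *)
have NON : N^T *m Om *m N + W'^T *m A *m W' = Om.
  have -> : N^T = 1%:M - W'^T *m W^T by rewrite [LHS]raddfB /= trmx1 trmx_mul.
  rewrite mulmxBl mul1mx -(mulmxA W'^T) mulmxBl.
  by rewrite -mulmxA WON mulmx0 subr0 mulmxBr mulmx1 mulmxA OmW subrK.
have NOW : N^T *m Om *m W = 0.
  apply: trmx_inj; rewrite !trmx_mul trmxK trOm mulNmx mulmxN.
  by rewrite mulmxA WON oppr0 trmx0.
have OmE m n (a : 'M_(p, m)) (b : 'M_(q, m)) (c : 'M_(p, n)) (e : 'M_(q, n)) :
    (col_mx a b)^T *m Om *m col_mx c e = a^T *m A *m c + b^T *m B *m e.
  by rewrite tr_col_mx mul_row_block !mulmx0 addr0 add0r mul_row_col.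
rewrite -[N]vsubmxK in NON NOW WON.
move: NON NOW WON isoXL; rewrite !OmE => NON NOW WON isoXL.
(* The rows of [[[W, N], [0, W']]] are reordered: [[0, W']] goes between the two row blocks of
   [[W, N]], so that [X] alone is the top-left corner. *)
exists (usubmx N), (col_mx W' (dsubmx N)).
rewrite [dsum_mx A (dsum_mx A B)]/dsum_mx tr_block_mx !mulmx_block.
rewrite !(mulmx0, mul0mx, addr0, add0r) -/Om !OmE.
rewrite !(trmx0, mulmx0, mul0mx, add0r) isoXL NOW WON.
by rewrite [W'^T *m A *m W' + _]addrC addrA NON.
Qed.

(** The dilation preserves [J + (J + J)]. Conjugation by [S], the identity on the first summand and
    the regrouping on the other, makes the inner sum a single standard form and keeps [X] in
    place. *)
Lemma symplectic_completion p q (X : 'M[R]_(p + p)) (L : 'M[R]_(q + q, p + p)) :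
    X^T *m Jmx R p *m X + L^T *m Jmx R q *m L = Jmx R p ->
  exists L12 (L21 : 'M[R]_((p + q) + (p + q), p + p)) L22,
    symplectic (dsum_mx (Jmx R p) (Jmx R (p + q))) (block_mx X L12 L21 L22) /\
    L21^T *m L21 = L^T *m L.
Proof.
move=> isoXL.
have [G [H]] := halmos_dilation (Jmx_tr p) (Jmx_tr q) (Jmx_sqr p) isoXL.
set D := dsum_mx (Jmx R p) _; set U := block_mx _ _ _ _ => sympU.
move: (regroup p q) (regroup_orth p q) (regroup_Jmx p q) (regroup_JmxV p q).
move=> P PtP PtJP PJPt; pose S := block_mx (1%:M : 'M_(p + p)) 0 0 P.
exists (G *m P^T), (P *m col_mx 0 L), (P *m H *m P^T); split; last first.
  rewrite trmx_mul mulmxA -(mulmxA _ P^T) PtP mulmx1.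
  by rewrite tr_col_mx mul_row_col mulmx0 add0r.
have -> : block_mx X (G *m P^T) (P *m col_mx 0 L) (P *m H *m P^T) =
    S *m U *m S^T.
  by rewrite /S /U !simpmx.
have SDS : S^T *m dsum_mx (Jmx R p) (Jmx R (p + q)) *m S = D.
  by rewrite /S {1}/dsum_mx !simpmx PtJP.
have SDSt : S *m D *m S^T = dsum_mx (Jmx R p) (Jmx R (p + q)).
  by rewrite /S /D {1}/dsum_mx !simpmx PJPt.
by rewrite /symplectic !trmx_mul trmxK -[RHS]SDSt -sympU -SDS !mulmxA.
Qed.

End Dilation.

Theorem proposition3p2 (R : realType) (d : nat) (hd : (1 <= d)%N)
    (X Y : 'M[R]_(d + d)) :
  let cond_i :=
    exists (d' : nat) (L12 : 'M[R]_(d + d, d' + d'))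
           (L21 : 'M[R]_(d' + d', d + d)) (L22 : 'M[R]_(d' + d')),
      [/\ (1 <= d')%N,
          symplectic (dsum_mx (Jmx R d) (Jmx R d')) (block_mx X L12 L21 L22)
        & L21^T *m L21 = Y] in
  let K := Jmx R d - X^T *m Jmx R d *m X in
  let cond_ii := hermitian_psd (complexify Y + 'i%C *: complexify K) in
  let cond_iii := hermitian_psd (complexify Y - 'i%C *: complexify K) in
  [/\ cond_i <-> cond_ii, cond_ii <-> cond_iii & cond_i <-> cond_iii] /\
  [/\ cond_i -> real_psd Y, cond_ii -> real_psd Y & cond_iii -> real_psd Y].
Proof.
move=> cond_i K cond_ii cond_iii.
have i_ii : cond_i -> cond_ii.
  case=> d' [L12 [L21 [L22 [_ sympL eqY]]]]; apply/hermitian_psd_rectP.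
  exists d', L21; split=> //; move: sympL.
  rewrite /symplectic /dsum_mx tr_block_mx !mulmx_block.
  rewrite !(mulmx0, mul0mx, addr0, add0r) => /eq_block_mx[eqJ _ _ _].
  by rewrite /K -[X in X - _]eqJ addrC addKr.
have ii_i : cond_ii -> cond_i.
  case/hermitian_psd_rectP=> n [L [eqY eqK]].
  have [|L12 [L21 [L22 [sympL eqL]]]] := @symplectic_completion R d n X L.
    by rewrite eqK addrC subrK.
  (* The copy of the original space added by the dilation makes [d'] positive, whatever [n] is. *)
  by exists (d + n)%N, L12, L21, L22; split; rewrite ?addn_gt0 ?hd ?eqL.
have ii_iii : cond_ii <-> cond_iii by exact: hermitian_psd_rectN.
have i_psd : cond_i -> real_psd Y.
  by case=> d' [L12 [L21 [L22 [_ _ <-]]]]; apply: gram_real_psd.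
(* With the conditions opaque, the rest is propositional: positivity of [Y] passes from (i) to (ii)
   and (iii) through the equivalences. *)
clearbody cond_i cond_ii cond_iii.
by split; split; tauto.
Qed.
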